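(* Let $a\in\mathbb{R}$ and $\sigma>0$, $\sigma\neq 1$. For each $n\in\mathbb{N}$ let $Z_1,Z_2,\dots$ be i.i.d. random variables with distribution function $$F_{a,\sigma}(x)=\tfrac12\Phi(x)+\tfrac12\Phi\Bigl(\frac{x-\sqrt{n}\,a}{\sigma}\Bigr),$$ and for $\beta>0$ let $$\mathcal{S}_n(\beta)=\sum_{j=1}^{\lfloor e^n\rfloor}e^{\beta\sqrt{n}\,Z_j}.$$ Define $$\beta^+=\begin{cases}\sqrt{2}/\sigma, & \text{if } a>(1-\sigma^2)/(\sqrt{2}\,\sigma),\\[2pt] \dfrac{2a}{1-\sigma^2}, & \text{if } (1-\sigma^2)/\sqrt{2}<a<(1-\sigma^2)/(\sqrt{2}\,\sigma),\\[2pt] \sqrt{2}, & \text{if } a<(1-\sigma^2)/\sqrt{2}.\end{cases}$$ If $(a,\sigma)$ belongs to one of these three regions and $0<\beta<\beta^+$, then $$\frac{\mathcal{S}_n(\beta)}{\mathbb{E}[\mathcal{S}_n(\beta)]}\ \xrightarrow{p}\ 1,\qquad n\to\infty.$$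
   Context: $\Phi$ is the distribution function of the standard normal law; $\xrightarrow{p}$ denotes convergence in probability. The common law of the $Z_j$ depends on $n$ (a triangular array). *)

(* Defs.v *)
From HB Require Import structures.
From mathcomp Require Import all_boot all_order all_algebra finmap.
From mathcomp Require Import all_classical all_reals all_analysis.

Set Implicit Arguments.
Unset Strict Implicit.
Unset Printing Implicit Defensive.

Import Order.TTheory GRing.Theory Num.Theory.
Import numFieldNormedType.Exports.

Local Open Scope classical_set_scope.
Local Open Scope ring_scope.

Definition Phi (R : realType) (x : R) : R := fine (normal_prob 0 1 `]-oo, x]).

Definition mixture_cdf (R : realType) (a sigma : R) (n : nat) (x : R) : R :=
  2^-1 * Phi x + 2^-1 * Phi ((x - Num.sqrt n%:R * a) / sigma).

(* Mutual independence: the product rule holds for every finite subfamily. *)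
Definition mutually_independent (d : measure_display) (T : measurableType d)
    (R : realType) (P : probability T R) (I : choiceType)
    (X : I -> {RV P >-> R}) : Prop :=
  forall (J : {fset I}) (B : I -> set R), (forall j, measurable (B j)) ->
    P (\bigcap_(j in [set` J]) (X j @^-1` B j)) =
    (\prod_(j <- J) P (X j @^-1` B j))%E.

Definition iid_with_cdf (d : measure_display) (T : measurableType d)
    (R : realType) (P : probability T R) (I : choiceType) (F : R -> R)
    (X : I -> {RV P >-> R}) : Prop :=
  mutually_independent X /\ forall j x, cdf (X j) x = (F x)%:E.

(* The sequence is indexed from 0, so [Z j] stands for $Z_{j+1}$. *)
Definition partition_sum (T : Type) (R : realType) (n : nat) (beta : R)
    (Z : nat -> T -> R) (w : T) : R :=
  \sum_(j < Num.truncn (expR n%:R : R)) expR (beta * Num.sqrt n%:R * Z j w).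

(* Only meant for [X n] measurable.  The limit being a constant, the
   probability space may vary with n. *)
Definition cvg_in_probability_to_cst (R : realType) (d : nat -> measure_display)
    (T : forall n, measurableType (d n)) (P : forall n, probability (T n) R)
    (X : forall n, T n -> R) (c : R) : Prop :=
  forall eps : R, 0 < eps ->
    (fun n => P n [set w | eps < `|X n w - c|]) @ \oo --> 0%E.

Definition region1 (R : realType) (a sigma : R) : bool :=
  (1 - sigma ^+ 2) / (Num.sqrt 2 * sigma) < a.

Definition region2 (R : realType) (a sigma : R) : bool :=
  (1 - sigma ^+ 2) / Num.sqrt 2 < a < (1 - sigma ^+ 2) / (Num.sqrt 2 * sigma).

Definition region3 (R : realType) (a sigma : R) : bool :=
  a < (1 - sigma ^+ 2) / Num.sqrt 2.

(* The final 0 is a junk value: outside the three (disjoint) regions the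
   critical parameter is not defined. *)
Definition beta_plus (R : realType) (a sigma : R) : R :=
  if region1 a sigma then Num.sqrt 2 / sigma
  else if region2 a sigma then 2 * a / (1 - sigma ^+ 2)
  else if region3 a sigma then Num.sqrt 2
  else 0.

(* Main.v *)
Require Import Defs.
From HB Require Import structures.
From mathcomp Require Import all_boot all_order all_algebra finmap.
From mathcomp Require Import all_classical all_reals all_analysis.
From mathcomp Require Import measurable_realfun ring lra.
Import Order.TTheory GRing.Theory Num.Theory.
Import numFieldNormedType.Exports.
Local Open Scope classical_set_scope.
Local Open Scope ring_scope.

Set Implicit Arguments.
Unset Strict Implicit.
Unset Printing Implicit Defensive.

(* Let N = floor(e^n), m = E e^(beta sqrt(n) Z) and p in (1, 2].  Truncating the
   summands at the level N m, Chebyshev's inequality for the truncated sum and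
   Markov's inequality for the rest bound the probability that S_n / (N m) is
   at distance more than eps from 1 by a constant times
     r_n = N (N m)^(-p) E e^(p beta sqrt(n) Z).
   Up to constants r_n is e^(-n c(p)), where
     c(p) = (p - 1) + p max(f_1(1), f_2(1)) - max(f_1(p), f_2(p))
   and e^(n f_i(p)) is the p-th moment of the i-th Gaussian component.  As
   c(1) = 0, it remains to see that c(p) > 0 for some p close to 1: this holds
   as soon as each component either has beta below its own critical value
   sqrt(2)/s_i or is strictly dominated by the other one at p = 1, which is what
   beta < beta^+ guarantees. *)

(** * Product formulas for two members of an independent family *)

Lemma independent_pair (d : measure_display) (T : measurableType d)
    (R : realType) (P : probability T R) (X : nat -> {RV P >-> R}) (i j : nat)
    (A B : set R) : mutually_independent X -> i != j ->
  measurable A -> measurable B ->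
  P (X i @^-1` A `&` X j @^-1` B) = (P (X i @^-1` A) * P (X j @^-1` B))%E.
Proof.
move=> indX ij mA mB.
have ji : (j == i) = false by rewrite eq_sym (negbTE ij).
(* The family takes the value [B] also off [{i, j}], where its values do not matter. *)
have /= := indX [fset i; j]%fset (fun k => if k == i then A else B).
rewrite big_fsetU1 ?inE//= big_seq_fset1 eqxx ji => <-; last first.
  by move=> k; case: ifP.
congr (P _); apply/seteqP; split => [w [wi wj] k /=|w /(_ _ _) w_].
  by rewrite !inE => /orP[|] /eqP ->; rewrite ?eqxx ?ji.
split.
  by have := w_ i; rewrite /= !inE !eqxx; exact.
by have := w_ j; rewrite /= !inE !eqxx orbT ji; exact.
Qed.

(** By independence, the law of the pair and the product of the two laws agree on rectangles, hence
    on all measurable sets; Tonelli then factors the integral. *)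
Lemma integral_independent_mul (d : measure_display) (T : measurableType d)
    (R : realType) (P : probability T R) (X : nat -> {RV P >-> R}) (i j : nat)
    (f g : R -> R) : mutually_independent X -> i != j ->
  measurable_fun setT f -> measurable_fun setT g ->
  (forall x, 0 <= f x) -> (forall x, 0 <= g x) ->
  (\int[P]_w (f (X i w) * g (X j w))%:E =
   \int[P]_w (f (X i w))%:E * \int[P]_w (g (X j w))%:E)%E.
Proof.
move=> indX ij mf mg f0 g0.
pose XX w := (X i w, X j w).
have mXX : measurable_fun setT XX by apply/measurable_fun_pair.
pose J : {RV P >-> (R * R)%type} := mfun_Sub (mem_set mXX).
have prodE (D : set (R * R)) : measurable D ->
    (distribution P (X i) \x distribution P (X j))%E D = distribution P J D.
  apply: (@product_measure_unique _ _ _ _ _ _ _ (distribution P J)) => // A B.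
  exact: independent_pair.
pose F (z : R * R) := (f z.1 * g z.2)%:E.
have mF : measurable_fun setT F.
  apply/measurable_EFinP; apply: measurable_funM.
    by apply: measurableT_comp => //; exact: measurable_fst.
  by apply: measurableT_comp => //; exact: measurable_snd.
have F0 z : (0 <= F z)%E by rewrite lee_fin mulr_ge0.
have -> : (\int[P]_w (f (X i w) * g (X j w))%:E =
    \int[distribution P J]_z F z)%E.
  by rewrite ge0_integral_distribution.
rewrite (eq_measure_integral
  (distribution P (X i) \x distribution P (X j))%E); last first.
  by move=> D mD _; exact/esym/prodE.
rewrite fubini_tonelli1//.
under eq_integral.
  move=> x _; rewrite /fubini_F /F/=.
  under eq_integral do rewrite EFinM.
  rewrite ge0_integralZl//; last 3 first.
  - exact/measurable_EFinP.
  - by move=> y _; rewrite lee_fin.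
  - by rewrite lee_fin.
  over.
rewrite /= ge0_integralZr//; last 3 first.
  exact/measurable_EFinP.
  by move=> y _; rewrite lee_fin.
  by apply: integral_ge0 => y _; rewrite lee_fin.
rewrite !ge0_integral_distribution//; try exact/measurable_EFinP;
by move=> y; rewrite lee_fin.
Qed.

(** * Exponential moments of Gaussian laws and of their mixture *)

(** The Radon-Nikodym derivative and [normal_pdf m s] have the same integral over every measurable
    set, so they agree almost everywhere and the explicit density may replace the derivative. *)
Lemma integral_normal_prob (R : realType) (m s : R) (f : R -> R) :
  measurable_fun setT f -> (forall x, 0 <= f x) ->
  (\int[normal_prob m s]_x (f x)%:E =
   \int[lebesgue_measure]_x (f x * normal_pdf m s x)%:E)%E.
Proof.
move=> mf f0.
have mpdf : measurable_fun setT (fun x => (normal_pdf m s x)%:E).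
  by apply/measurable_EFinP; exact: measurable_normal_pdf.
have dom := normal_prob_dominates m s.
have irn := Radon_Nikodym_SigmaFinite.f_integrable dom.
have mrn := measurable_int _ irn.
rewrite -(Radon_Nikodym_SigmaFinite.change_of_variables dom)//; last first.
  exact/measurable_EFinP.
under [RHS]eq_integral do rewrite EFinM.
apply: ae_eq_integral => //.
- by apply: emeasurable_funM => //; exact/measurable_EFinP.
- by apply: emeasurable_funM => //; exact/measurable_EFinP.
apply: ae_eqe_mul2l; apply: integral_ae_eq => //.
by move=> E _ mE; rewrite -Radon_Nikodym_SigmaFinite.f_integral.
Qed.

(* Completing the square: tilting N(m, s^2) by [expR (t * x)] gives, up to a
   constant factor, N(m + t s^2, s^2). *)
Lemma normal_prob_mgf (R : realType) (m s t : R) : s != 0 ->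
  (\int[normal_prob m s]_x (expR (t * x))%:E =
   (expR (t * m + t ^+ 2 * s ^+ 2 / 2))%:E)%E.
Proof.
move=> s0; have mexp : measurable_fun setT (fun x : R => expR (t * x)).
  by apply: measurableT_comp => //; exact: measurable_funM.
rewrite integral_normal_prob//.
under eq_integral => x _.
  rewrite (_ : _ * _ = expR (t * m + t ^+ 2 * s ^+ 2 / 2) *
      normal_pdf (m + t * s ^+ 2) s x); last first.
    rewrite !normal_pdfE// mulrCA [RHS]mulrCA /normal_fun -!expRD.
    by congr (_ * expR _); field.
  rewrite EFinM; over.
rewrite ge0_integralZl//; last 2 first.
- by apply/measurable_EFinP; exact: measurable_normal_pdf.
- by move=> x _; rewrite lee_fin normal_pdf_ge0.
by rewrite integral_normal_pdf mule1.
Qed.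

(** The intervals []a, b]] form a pi-system generating the Borel sets, the sets []-n, n]] exhaust
    the line, and the mass of []a, b]] is a difference of masses of half-lines, all of them
    finite. *)
Lemma cdf_measure_unique (R : realType) (m1 m2 : {measure set R -> \bar R}) :
  (m1 setT < +oo)%E ->
  (forall x, m1 `]-oo, x]%classic = m2 `]-oo, x]%classic) ->
  forall A, measurable A -> m1 A = m2 A.
Proof.
move=> m1fin m12 A mA.
have m1lt B : measurable B -> (m1 B < +oo)%E.
  by move=> mB; apply: le_lt_trans m1fin; apply: le_measure => //; rewrite inE.
apply: (measure_unique (@ocitv R) (fun n => `]-n%:R, n%:R]%classic)) => //.
- exact: ocitvI.
- by move=> n; exact: is_ocitv.
- rewrite -subTset => x _ /=; exists (Num.truncn `|x|).+1 => //=.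
  have := truncnS_gt `|x|; rewrite ltr_norml => /andP[x1 x2].
  by rewrite in_itv/= x1 ltW.
- move=> _ [[a b] _ <-] /=.
  have [ab|ba] := leP a b; last first.
    by rewrite set_itv_ge ?measure0// bnd_simp -leNgt ltW.
  have -> : `]a, b]%classic = `]-oo, b]%classic `\` `]-oo, a]%classic.
    by rewrite -[RHS]setCK setCD setCitvl setUC -[LHS]setCK setCitv.
  rewrite !measureD//; try exact: m1lt; last first.
    by have := m1lt `]-oo, b]%classic; rewrite m12; exact.
  rewrite setIidr; last by apply: subset_itvl; rewrite bnd_simp.
  by congr (_ - _)%E; exact: m12.
- by move=> n; apply: m1lt.
Qed.

(* The law of [X] is the half-sum of the images of N(0, 1) under the identity
   and under [x |-> s * x + sqrt n * a]. *)
Lemma mixture_mgf (R : realType) (a s : R) (n : nat) (d : measure_display)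
    (T : measurableType d) (P : probability T R) (X : {RV P >-> R}) (t : R) :
  0 < s -> (forall x, cdf X x = (mixture_cdf a s n x)%:E) ->
  (\int[P]_w (expR (t * X w))%:E =
   (2^-1 * expR (t ^+ 2 / 2) +
    2^-1 * expR (t * (Num.sqrt n%:R * a) + t ^+ 2 * s ^+ 2 / 2))%:E)%E.
Proof.
move=> s0 cdfX; set b := Num.sqrt n%:R * a.
pose N : probability (measurableTypeR R) R := normal_prob 0 1.
have maff (u v : R) :
    measurable_fun setT ((fun x => u * x + v) : measurableTypeR R -> R).
  by apply: measurable_funD => //; exact: measurable_funM.
pose aff u v : {RV N >-> R} := mfun_Sub (mem_set (maff u v)).
have half0 : (0 : R) <= 2^-1 by rewrite invr_ge0.
pose h : {nonneg R} := NngNum half0.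
(* The identity is written [aff 1 0] so that the single formula [affE] covers both components. *)
pose Q := measure_add (mscale h (distribution N (aff 1 0)))
                      (mscale h (distribution N (aff s b))).
have XQ A : measurable A -> distribution P X A = Q A.
  apply: (@cdf_measure_unique R (distribution P X)).
    exact: le_lt_trans (probability_le1 P measurableT) (ltry 1).
  move=> x; transitivity ((mixture_cdf a s n x)%:E); first exact: cdfX.
  transitivity (mscale h (distribution N (aff 1%R 0%R)) `]-oo, x]%classic +
      mscale h (distribution N (aff s b)) `]-oo, x]%classic)%E; last first.
    exact/esym/measure_addE.
  rewrite /mscale/= /mixture_cdf /Phi EFinD !EFinM.
  have N_fin B : measurable B -> N B \is a fin_num by exact: fin_num_measure.
  rewrite !fineK ?N_fin//.
  congr (_ * N _ + _ * N _)%E; apply/seteqP; split => y /=; rewrite !in_itv/=.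
  - by rewrite mul1r addr0.
  - by rewrite mul1r addr0.
  - by rewrite ler_pdivlMr// lerBrDr mulrC.
  - by rewrite ler_pdivlMr// lerBrDr mulrC.
have mexp (u : R) : measurable_fun setT (fun x : R => (expR (u * x))%:E).
  by apply/measurable_EFinP/measurableT_comp => //; exact: measurable_funM.
have exp0 (x : R) : (0 <= (expR (t * x))%:E)%E by rewrite lee_fin expR_ge0.
have affE u v : (\int[distribution N (aff u v)]_x (expR (t * x))%:E =
    (expR (t * v + t ^+ 2 * u ^+ 2 / 2))%:E)%E.
  rewrite ge0_integral_distribution//=.
  under eq_integral do rewrite mulrDr mulrA expRD mulrC EFinM.
  rewrite ge0_integralZl//; last first.
    by apply/measurable_EFinP/measurableT_comp => //; exact: measurable_funM.
  rewrite normal_prob_mgf ?oner_eq0// -EFinM -expRD.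
  by rewrite mulr0 add0r expr1n mulr1 exprMn.
transitivity (\int[distribution P X]_x (expR (t * x))%:E)%E.
  by rewrite ge0_integral_distribution.
rewrite (eq_measure_integral Q); last by move=> A mA _; exact: XQ.
rewrite ge0_integral_measure_add// !ge0_integral_mscale//.
by rewrite !affE mulr0 add0r expr1n mulr1 EFinD !EFinM.
Qed.

(** * Variance of sums of bounded functions of independent variables *)

Lemma bounded_Lfun2 (d : measure_display) (T : measurableType d)
    (R : realType) (P : probability T R) (f : T -> R) (M : R) :
  measurable_fun setT f -> (forall w, 0 <= f w <= M) -> f \in Lfun P 2%:E.
Proof.
move=> mf fM; rewrite inE/=; apply/andP; split; rewrite inE//=.
rewrite /finite_norm unlock poweR_lty//.
apply: (@le_lt_trans _ _ (\int[P]_w (cst (M ^+ 2)%:E w))%E); last first.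
  by rewrite integral_cst//= probability_setT mule1 ltry.
apply: ge0_le_integral => //.
- by move=> w _; rewrite lee_fin powR_ge0.
- apply/measurable_EFinP.
  apply: (@measurableT_comp _ _ _ _ _ _ (fun x : R => x `^ 2)) => //.
  exact: measurableT_comp.
- move=> w _; have /andP[f0 fleM] := fM w.
  by rewrite lee_fin powR_mulrn// ger0_norm// lerXn2r// nnegrE (le_trans f0).
Qed.

Section variance_of_independent_sum.
Context (d : measure_display) (T : measurableType d) (R : realType).
Context (P : probability T R) (X : nat -> {RV P >-> R}).
Context (h : R -> R) (M : R) (indX : mutually_independent X).
Context (mh : measurable_fun setT h) (hM : forall x, 0 <= h x <= M).

Let Y j w := h (X j w).

Let Y2 j : Y j \in Lfun P 2%:E.
Proof.
apply: (@bounded_Lfun2 _ _ _ _ _ M) => [|w]; last exact: hM.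
exact: (measurableT_comp mh (measurable_funPT (X j))).
Qed.

Let Y1 j : Y j \in Lfun P 1.
Proof. by apply: Lfun_subset12 => //; rewrite fin_num_measure. Qed.

Let S n w := \sum_(j < n) h (X j w).

Let S0 : S 0 = cst 0.
Proof. by apply/funext => w; rewrite /S big_ord0. Qed.

Let SS n : S n.+1 = S n \+ Y n.
Proof. by apply/funext => w; rewrite /S big_ord_recr. Qed.

Let S2 n : S n \in Lfun P 2%:E.
Proof.
elim: n => [|n IHn]; first by rewrite S0 Lfun_cst.
by rewrite SS rpredD// lee1n.
Qed.

Let covariance_indep i j : i != j -> covariance P (Y i) (Y j) = 0%E.
Proof.
move=> ij; rewrite covarianceE//; last exact: Lfun2_mul_Lfun1.
have h0 x : 0 <= h x by case/andP: (hM x).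
have EY k : (\int[P]_w (h (X k w))%:E = 'E_P[Y k])%E by rewrite unlock.
have -> : ('E_P[Y i * Y j] = 'E_P[Y i] * 'E_P[Y j])%E.
  by rewrite -!EY unlock -(integral_independent_mul indX ij).
by rewrite subee// fin_numM// expectation_fin_num.
Qed.

Let covariance_sum n k : (n <= k)%N -> covariance P (S n) (Y k) = 0%E.
Proof.
elim: n => [|n IHn] nk; first by rewrite S0 covariance_cst_l.
rewrite SS covarianceDl// IHn ?(ltnW nk)// covariance_indep ?adde0//.
by rewrite neq_ltn nk.
Qed.

(** The covariance of a partial sum with the next term vanishes, so variances add; each is at most
    the second moment. Boundedness of [h] puts all terms in L^2. *)
Lemma variance_sum_independent_le n :
  ('V_P[fun w => \sum_(j < n) h (X j w)]%R <=
   \sum_(j < n) \int[P]_w ((h (X j w)) ^+ 2)%:E)%E.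
Proof.
rewrite -/(S n); elim: n => [|n IHn].
  by rewrite S0 variance_cst big_ord0.
rewrite big_ord_recr/= SS varianceD// covariance_sum// mule0 adde0.
apply: leeD => //; rewrite varianceE//.
rewrite leeBlDr ?fin_numX ?expectation_fin_num//.
by rewrite [in leLHS]unlock leeDl// sqre_ge0.
Qed.

End variance_of_independent_sum.

(** * Weak law by truncation *)

(** Chebyshev handles the truncated summands [h], Markov the remainders [k]. The condition
    [r <= eps / 2] keeps the mean of the remainder sum within half of the tolerance [eps N m]. *)
Lemma truncated_weak_law (d : measure_display) (T : measurableType d)
    (R : realType) (P : probability T R) (X : nat -> {RV P >-> R})
    (h k : R -> R) (N : nat) (M m r eps : R) :
  mutually_independent X -> (0 < N)%N -> 0 < m -> 0 < eps -> r <= eps / 2 ->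
  measurable_fun setT h -> measurable_fun setT k ->
  (forall x, 0 <= h x <= M) -> (forall x, 0 <= k x) ->
  (forall j, \int[P]_w (h (X j w) + k (X j w))%:E = m%:E)%E ->
  (forall j, \int[P]_w (k (X j w))%:E <= (r * m)%:E)%E ->
  (forall j, \int[P]_w ((h (X j w)) ^+ 2)%:E <= (r * (N%:R * m ^+ 2))%:E)%E ->
  (P [set w | (eps <
      `|(\sum_(j < N) (h (X j w) + k (X j w))) / (N%:R * m) - 1|)%R]
     <= ((4 / eps ^+ 2 + 2 / eps) * r)%:E)%E.
Proof.
move=> indX N0 m0 eps0 reps mh mk hM k0 Eg Ek Eh.
have NR0 : 0 < N%:R :> R by rewrite ltr0n.
have Nm0 : 0 < N%:R * m by rewrite mulr_gt0.
pose e := eps / 2 * (N%:R * m).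
have e0 : 0 < e by rewrite mulr_gt0// divr_gt0.
have h0 x : 0 <= h x by case/andP: (hM x).
have mhX j : measurable_fun setT (fun w => h (X j w)).
  exact: (measurableT_comp mh (measurable_funPT (X j))).
have mkX j : measurable_fun setT (fun w => k (X j w)).
  exact: (measurableT_comp mk (measurable_funPT (X j))).
have mSh : measurable_fun setT (fun w => \sum_(j < N) h (X j w)).
  exact: measurable_sum.
have mSk : measurable_fun setT (fun w => \sum_(j < N) k (X j w)).
  exact: measurable_sum.
pose Sh : {RV P >-> R} := mfun_Sub (mem_set mSh).
pose Sk : {RV P >-> R} := mfun_Sub (mem_set mSk).
have ESk : ('E_P[Sk] = \sum_(j < N) \int[P]_w (k (X j w))%:E)%E.
  rewrite unlock; under eq_integral do rewrite /= -sumEFin.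
  rewrite ge0_integral_sum// => [j|j w _]; last by rewrite lee_fin.
  exact/measurable_EFinP.
have ESh : ('E_P[Sh] = \sum_(j < N) \int[P]_w (h (X j w))%:E)%E.
  rewrite unlock; under eq_integral do rewrite /= -sumEFin.
  rewrite ge0_integral_sum// => [j|j w _]; last by rewrite lee_fin.
  exact/measurable_EFinP.
have ESk_le : ('E_P[Sk] <= (N%:R * (r * m))%:E)%E.
  rewrite ESk mulr_natl -[in leRHS](card_ord N) -sumr_const -sumEFin.
  exact: lee_sum.
have ESk0 : (0 <= 'E_P[Sk])%E.
  by apply: expectation_ge0 => w; exact: sumr_ge0.
have ESh0 : (0 <= 'E_P[Sh])%E.
  by apply: expectation_ge0 => w; exact: sumr_ge0.
have ES : ('E_P[Sh] + 'E_P[Sk] = (N%:R * m)%:E)%E.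
  rewrite ESh ESk -big_split/= mulr_natl -[in RHS](card_ord N) -sumr_const.
  rewrite -sumEFin; apply: eq_bigr => j _; rewrite -(Eg j).
  under [RHS]eq_integral do rewrite EFinD.
  rewrite ge0_integralD//.
  - by move=> w _; rewrite lee_fin.
  - exact/measurable_EFinP.
  - by move=> w _; rewrite lee_fin.
  - exact/measurable_EFinP.
have ESk_fin : ('E_P[Sk])%E \is a fin_num.
  by rewrite ge0_fin_numE// (le_lt_trans ESk_le)// ltry.
have ESh_fin : ('E_P[Sh])%E \is a fin_num.
  by rewrite ge0_fin_numE// (@le_lt_trans _ _ (N%:R * m)%:E) ?ltry// -ES leeDl.
pose A := [set w | e <= `|Sh w - fine ('E_P[Sh])%E|].
pose B := [set w | e <= `|Sk w|].
have mA : measurable A.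
  rewrite /A -[X in measurable X]setTI.
  apply: measurable_fun_le => //.
  by apply: measurableT_comp => //; exact: measurable_funB.
have mB : measurable B.
  rewrite /B -[X in measurable X]setTI.
  by apply: measurable_fun_le => //; exact: measurableT_comp.
set D := [set w | _].
(* Off [A] and [B], [Sh] is within [e] of its mean, and so is [Sk], since [Sk] and its mean both lie
   in [0, e]; the total deviation is then at most [2 e = eps N m]. *)
have DAB : D `<=` A `|` B.
  move=> w; rewrite /D/= big_split/= -/(Sh w) -/(Sk w) => Dw.
  apply: contrapT => /not_orP[]; rewrite /A /B /mkset => /negP + /negP.
  rewrite -!ltNge => Aw Bw.
  have Sk0 : 0 <= Sk w by exact: sumr_ge0.
  have K0 : 0 <= fine ('E_P[Sk])%E by rewrite fine_ge0.
  have Ke : fine ('E_P[Sk])%E <= e.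
    rewrite -lee_fin fineK// (le_trans ESk_le)// lee_fin /e.
    by rewrite mulrCA ler_wpM2r// ltW.
  have ES' : fine ('E_P[Sh])%E + fine ('E_P[Sk])%E = N%:R * m.
    by rewrite -fineD// ES.
  move: Dw; rewrite ltNge => /negP; apply.
  have -> : (Sh w + Sk w) / (N%:R * m) - 1 =
      (Sh w + Sk w - N%:R * m) / (N%:R * m).
    by rewrite mulrBl divff// gt_eqF.
  rewrite normrM normfV (gtr0_norm Nm0) ler_pdivrMr//.
  rewrite (_ : eps * _ = e + e); last by rewrite /e; field.
  move: Aw Bw; rewrite -ES' !ltr_norml => /andP[A1 A2] /andP[B1 B2].
  rewrite ler_norml; apply/andP; split; lra.
(* The constants [4 / eps^2] here and [2 / eps] for [B] come from dividing [N r N m^2] by [e^2] and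
   [N r m] by [e]. *)
have PA : (P A <= (4 / eps ^+ 2 * r)%:E)%E.
  apply: le_trans (chebyshev Sh e0) _.
  have Vle : ('V_P[Sh] <= (N%:R * (r * (N%:R * m ^+ 2)))%:E)%E.
    apply: le_trans (variance_sum_independent_le indX mh hM N) _.
    apply: (@le_trans _ _ (\sum_(j < N) (r * (N%:R * m ^+ 2))%:E)%E).
      exact: lee_sum.
    by rewrite sumEFin sumr_const card_ord (mulr_natl (r * _)).
  apply: le_trans (lee_wpmul2l _ Vle) _.
    by rewrite lee_fin invr_ge0 exprn_ge0// ltW.
  rewrite -EFinM lee_fin /e le_eqVlt; apply/orP; left; apply/eqP.
  by field; rewrite !gt_eqF.
have PB : (P B <= (2 / eps * r)%:E)%E.
  have := @markov _ _ _ P Sk id e e0.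
  move=> /(_ (@measurable_id _ _ _) (fun _ => id)).
  have PBE : P [set w | (e%:E <= `|(Sk w)%:E|)%E] = P B.
    by congr (P _); apply/seteqP; split => w /=; rewrite lee_fin.
  move=> /(_ (fun _ _ _ _ => id)); rewrite PBE => mkv.
  have -> : (2 / eps * r)%:E = (e^-1%:E * (N%:R * (r * m))%:E)%E.
    by rewrite -EFinM /e; congr EFin; field; rewrite !gt_eqF.
  rewrite lee_pdivlMl//; apply: le_trans mkv _.
  apply: le_trans ESk_le; rewrite le_eqVlt; apply/orP; left; apply/eqP.
  by congr expectation; apply/funext => w /=; rewrite ger0_norm// sumr_ge0.
rewrite mulrDl EFinD; apply: le_trans (leeD PA PB).
apply: le_trans (measureU2 P mA mB).
apply: le_measure => //; rewrite inE//; last exact: measurableU.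
pose F w := `|(\sum_(j < N) (h (X j w) + k (X j w))) / (N%:R * m) - 1|.
have -> : D = ~` [set w | F w <= eps].
  by apply/seteqP; split => w /=; rewrite /D/= ltNge => /negP.
apply: measurableC; rewrite -[X in measurable X]setTI.
apply: measurable_fun_le => //.
apply: measurableT_comp => //; apply: measurable_funB => //.
apply: measurable_funM => //; apply: measurable_sum => j.
exact: measurable_funD.
Qed.

(* With [L = ln (N m)], the contributions of [lam * x <= L] and [L < lam * x]
   are both controlled by the [p]-th moment: [e^y <= e^((1-p)L + p y)] for
   [y > L] and [e^(2y) <= e^((2-p)L + p y)] for [y <= L]. *)
Lemma exp_sum_weak_law (d : measure_display) (T : measurableType d)
    (R : realType) (P : probability T R) (X : nat -> {RV P >-> R})
    (N : nat) (lam p m mp eps : R) :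
  mutually_independent X -> (0 < N)%N -> 0 < m -> 0 < eps -> 1 <= p <= 2 ->
  (forall j, \int[P]_w (expR (lam * X j w))%:E = m%:E)%E ->
  (forall j, \int[P]_w (expR (p * lam * X j w))%:E = mp%:E)%E ->
  let r := N%:R * expR (- (p * ln (N%:R * m))) * mp in
  r <= eps / 2 ->
  (P [set w | (eps <
      `|(\sum_(j < N) expR (lam * X j w)) / (N%:R * m) - 1|)%R]
     <= ((4 / eps ^+ 2 + 2 / eps) * r)%:E)%E.
Proof.
move=> indX N0 m0 eps0 /andP[p1 p2] Em Emp r reps.
have NR0 : 0 < N%:R :> R by rewrite ltr0n.
have Nm0 : 0 < N%:R * m by rewrite mulr_gt0.
pose L := ln (N%:R * m).
have expL : expR L = N%:R * m by rewrite lnK.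
pose h x := if lam * x <= L then expR (lam * x) else 0.
pose k x := if lam * x <= L then 0 else expR (lam * x).
have hk x : expR (lam * x) = h x + k x.
  by rewrite /h /k; case: ifP; rewrite ?addr0 ?add0r.
have mlam (u : R) : measurable_fun setT (fun x : R => u * x).
  exact: measurable_funM.
have mexp (u : R) : measurable_fun setT (fun x : R => expR (u * x)).
  exact: measurableT_comp.
have mcond : measurable_fun setT (fun x => lam * x <= L).
  exact: measurable_fun_ler.
have mh : measurable_fun setT h by exact: measurable_fun_ifT.
have mk : measurable_fun setT k by exact: measurable_fun_ifT.
have k0 x : 0 <= k x by rewrite /k; case: ifP => // _; exact: expR_ge0.
have hM x : 0 <= h x <= N%:R * m.
  rewrite /h; case: ifP => [xL|_]; last by rewrite lexx ltW.
  by rewrite expR_ge0 -expL ler_expR.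
have mX (f : R -> R) j : measurable_fun setT f ->
    measurable_fun setT (fun w => (f (X j w))%:E).
  move=> mf; apply/measurable_EFinP.
  exact: (measurableT_comp mf (measurable_funPT (X j))).
have Eb (c : R) j (f : R -> R) : measurable_fun setT f ->
    (forall x, 0 <= f x <= expR c * expR (p * lam * x)) ->
    (\int[P]_w (f (X j w))%:E <= (expR c * mp)%:E)%E.
  move=> mf fle; rewrite EFinM -(Emp j) -ge0_integralZl//; last first.
    exact: (mX (fun x => expR (p * lam * x))).
  apply: ge0_le_integral => //.
  - by move=> w _; rewrite lee_fin; case/andP: (fle (X j w)).
  - exact: (mX _ j mf).
  - exact: (mX (fun x => expR c * expR (p * lam * x)) j (measurable_funM _ _)).
  - by move=> w _; rewrite -EFinM lee_fin; case/andP: (fle (X j w)).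
under eq_set do under eq_bigr do rewrite hk.
apply: (truncated_weak_law indX N0 m0 eps0 reps mh mk hM k0).
- by move=> j; rewrite -(Em j); apply: eq_integral => w _; rewrite hk.
(* Since [N m = e^L], the target [r m] is [e^((1-p)L) mp], and likewise [r N m^2] below is
   [e^((2-p)L) mp]. *)
- move=> j; have -> : r * m = expR ((1 - p) * L) * mp.
    by rewrite mulrBl mul1r expRD expL /r -/L; ring.
  apply: Eb => // x; rewrite k0 /k -expRD; case: ifP => [_|/negbT].
    exact: expR_ge0.
  by rewrite -ltNge ler_expR => Lx; nra.
- move=> j; have -> : r * (N%:R * m ^+ 2) = expR ((2 - p) * L) * mp.
    by rewrite mulrBl mulrDl mul1r !expRD expL /r -/L; ring.
  apply: (Eb _ _ (fun x => h x ^+ 2)); first exact: measurable_funX.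
  move=> x; rewrite sqr_ge0 /h -expRD; case: ifP => [xL|_].
    by rewrite expr2 -expRD ler_expR; nra.
  by rewrite expr0n expR_ge0.
Qed.

(** * Positivity of the exponent gap for p slightly above 1 *)

(** With p = 1 + t and D = M - (b + v/2), the right side minus the left side is t + p D - p t v/2.
    If v < 2, the term t wins once p v < 2; if D > 0, the term p D wins once t v <= D. *)
Lemma exponent_gap (R : realType) (b v M : R) : 0 < v -> b + v / 2 <= M ->
  v < 2 \/ b + v / 2 < M ->
  exists2 t0, 0 < t0 & forall t, 0 < t <= t0 ->
    (1 + t) * b + (1 + t) ^+ 2 * v / 2 < t + (1 + t) * M.
Proof.
move=> v0 fM [v2|fltM].
  exists ((2 - v) / (2 * v)) => [|t /andP[t0 tle]].
    by rewrite divr_gt0 ?subr_gt0 ?mulr_gt0.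
  have : t * (2 * v) <= 2 - v by rewrite -ler_pdivlMr ?mulr_gt0.
  by move=> tv; nra.
pose dM := M - (b + v / 2).
have dM0 : 0 < dM by rewrite subr_gt0.
exists (Num.min 1 (dM / v)) => [|t].
  by rewrite lt_min ltr01 divr_gt0.
rewrite le_min => /and3P[t0 t1]; rewrite ler_pdivlMr// /dM => tv.
by nra.
Qed.

(* Each Gaussian component is either below its own critical parameter, or its
   contribution to the expectation is exponentially negligible. *)
Lemma components_controlled (R : realType) (a sigma beta : R) :
  0 < sigma -> sigma <> 1 ->
  [\/ region1 a sigma, region2 a sigma | region3 a sigma] ->
  0 < beta -> beta < beta_plus a sigma ->
  (beta ^+ 2 < 2 \/ beta ^+ 2 / 2 < beta * a + beta ^+ 2 * sigma ^+ 2 / 2) /\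
  (beta ^+ 2 * sigma ^+ 2 < 2 \/
   beta * a + beta ^+ 2 * sigma ^+ 2 / 2 < beta ^+ 2 / 2).
Proof.
move=> s0 /eqP s1 reg b0.
set q : R := Num.sqrt 2.
have q0 : 0 < q by rewrite sqrtr_gt0.
have q2 : q ^+ 2 = 2 by rewrite sqr_sqrtr.
have qs0 : 0 < q * sigma by rewrite mulr_gt0.
have ltq (x : R) : 0 < x -> x < q -> x ^+ 2 < 2.
  by move=> x0 xq; rewrite -q2 ltr_pXn2r// nnegrE ltW.
(* The thresholds for [a] are brought to the form [x (1 - sigma^2) / 2], with x = sqrt 2 or sqrt 2 /
   sigma; comparing [a] with this quantity tells which component dominates at parameter x. *)
have div_q (x : R) : x / q = x * q / 2 by rewrite -q2; field; rewrite gt_eqF.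
have div_qs (x : R) : x / (q * sigma) = x * (q / sigma) / 2.
  by rewrite -q2; field; rewrite !gt_eqF.
have half_lt (x : R) : x * (1 - sigma ^+ 2) / 2 < a -> 0 < x ->
    x ^+ 2 / 2 < x * a + x ^+ 2 * sigma ^+ 2 / 2.
  by move=> xa x0; nra.
have half_gt (x : R) : a < x * (1 - sigma ^+ 2) / 2 -> 0 < x ->
    x * a + x ^+ 2 * sigma ^+ 2 / 2 < x ^+ 2 / 2.
  by move=> xa x0; nra.
rewrite /beta_plus; case: ifP => [r1|nr1].
  rewrite /region1 -/q div_qs in r1.
  rewrite -/q => blt; have bs : beta * sigma < q by rewrite -ltr_pdivlMr.
  split; last by left; rewrite -exprMn ltq// mulr_gt0.
  have [bq|qb] := ltP beta q; first by left; exact: ltq.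
  (* Now sqrt 2 <= beta < sqrt 2 / sigma forces sigma < 1, so replacing beta by sqrt 2 / sigma only
     increases [beta (1 - sigma^2) / 2]. *)
  right; apply: half_lt => //; apply: le_lt_trans r1.
  have slt1 : sigma < 1.
    by rewrite ltNge; apply/negP => sge1; nra.
  have : 0 <= 1 - sigma ^+ 2 by nra.
  by move: blt; set u := q / sigma => blt s2; nra.
case: ifP => [/andP[a1 a2] blt|nr2].
  rewrite -/q div_q in a1; rewrite -/q div_qs in a2.
  (* At [2 a / (1 - sigma^2)] the two exponents cross. For sigma < 1 the second component dominates
     below it, and [a2] gives beta sigma < sqrt 2; for sigma > 1 the sign of 1 - sigma^2 exchanges
     the roles, and [a1] gives beta < sqrt 2. *)
  have [slt1|sgt1] := ltP sigma 1.
    have s2 : 0 < 1 - sigma ^+ 2 by nra.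
    have ba : beta * (1 - sigma ^+ 2) < 2 * a by rewrite -ltr_pdivlMr.
    split; first by right; apply: half_lt => //; lra.
    left; rewrite -exprMn; apply: ltq; first by rewrite mulr_gt0.
    rewrite -ltr_pdivlMr//.
    by rewrite -(ltr_pM2r s2); lra.
  have sgt : 1 < sigma by rewrite lt_neqAle eq_sym s1.
  have s2 : 1 - sigma ^+ 2 < 0 by nra.
  have ba : 2 * a < beta * (1 - sigma ^+ 2) by rewrite -ltr_ndivlMr.
  split; last by right; apply: half_gt => //; lra.
  by left; apply: ltq => //; rewrite -(ltr_nM2r s2); lra.
case: ifP => [r3 blt|nr3]; last by case: reg; rewrite ?nr1 ?nr2 ?nr3.
rewrite /region3 -/q div_q in r3.
rewrite -/q in blt; split; first by left; exact: ltq.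
have [bs|qb] := ltP (beta * sigma) q.
  by left; rewrite -exprMn ltq// mulr_gt0.
(* Here beta < sqrt 2 <= beta sigma forces sigma > 1, and 1 - sigma^2 < 0 makes the threshold at
   beta larger than the one at sqrt 2. *)
right; apply: half_gt => //; apply: lt_le_trans r3 _.
have sgt1 : 1 < sigma by rewrite ltNge; apply/negP => sle1; nra.
have s2 : 1 - sigma ^+ 2 < 0 by nra.
by nra.
Qed.

(** * Exponential decay of the moment ratio *)

(** For n >= 1, e^n >= 1 + n >= 2, so the integer part exceeds e^n - 1 >= e^n / 2. *)
Lemma truncn_expR_ge (R : realType) (n : nat) : (0 < n)%N ->
  expR n%:R / 2 <= (Num.truncn (expR n%:R : R))%:R :> R.
Proof.
move=> n0; set e : R := expR n%:R.
have e2 : 2 <= e.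
  apply: le_trans (expR_ge1Dx _).
  by rewrite -[leLHS]/(1 + 1) lerD2l ler1n.
have := truncnS_gt e; rewrite -addn1 natrD; lra.
Qed.

(* The quantity [N (N m)^-p E e^(p beta sqrt(n) Z)] governing the weak law. *)
Lemma moment_ratio_le (R : realType) (f1 f2 g1 g2 p c N m : R) (n : nat) :
  (0 < n)%N -> 1 <= p ->
  c + g1 <= (p - 1) + p * Num.max f1 f2 ->
  c + g2 <= (p - 1) + p * Num.max f1 f2 ->
  N = (Num.truncn (expR n%:R : R))%:R ->
  m = 2^-1 * expR (n%:R * f1) + 2^-1 * expR (n%:R * f2) ->
  N * expR (- (p * ln (N * m))) *
    (2^-1 * expR (n%:R * g1) + 2^-1 * expR (n%:R * g2)) <=
  expR ((2 * p - 1) * ln 2) * expR (- c) ^+ n.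
Proof.
set M := Num.max f1 f2 => n0 p1 cg1 cg2 NE mE.
have Nge : expR n%:R / 2 <= N by rewrite NE; exact: truncn_expR_ge.
have N0 : 0 < N by apply: lt_le_trans Nge; rewrite divr_gt0 ?expR_gt0.
have mge : expR (n%:R * M) / 2 <= m.
  rewrite mE /M; case: (leP f1 f2) => _;
    have := expR_gt0 (n%:R * f1); have := expR_gt0 (n%:R * f2); lra.
have m0 : 0 < m by apply: lt_le_trans mge; rewrite divr_gt0 ?expR_gt0.
have e2 : expR (ln 2) = 2 :> R by rewrite lnK// posrE.
have lnN : n%:R - ln 2 <= ln N by rewrite -ler_expR expRB e2 lnK ?posrE.
have lnm : n%:R * M - ln 2 <= ln m by rewrite -ler_expR expRB e2 lnK ?posrE.
(* The prefactor is N^(1-p) m^(-p). The bounds N >= e^n / 2 and m >= e^(nM) / 2 cost 2^(p-1) and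
   2^p, whence the constant 2^(2p-1). *)
have G_le (g : R) : c + g <= (p - 1) + p * M ->
    N * expR (- (p * ln (N * m))) * expR (n%:R * g) <=
    expR ((2 * p - 1) * ln 2) * expR (- c) ^+ n.
  move=> cg; rewrite -expRM_natl -[X in X * expR (- _)]lnK ?posrE//.
  rewrite lnM ?posrE// -!expRD ler_expR.
  have p1lnN : (p - 1) * (n%:R - ln 2) <= (p - 1) * ln N.
    by rewrite ler_wpM2l// subr_ge0.
  have plnm : p * (n%:R * M - ln 2) <= p * ln m.
    by rewrite ler_wpM2l// (le_trans ler01).
  have ncg : n%:R * (c + g) <= n%:R * (p - 1 + p * M) by rewrite ler_wpM2l.
  by lra.
have := G_le _ cg1; have := G_le _ cg2; lra.
Qed.

(** * Choice of p and passage to the limit *)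

Unset Implicit Arguments.

Theorem theorem4p1 (R : realType) (a sigma : R)
    (sigma_gt0 : 0 < sigma) (sigma_neq1 : sigma <> 1)
    (d : nat -> measure_display) (T : forall n : nat, measurableType (d n))
    (P : forall n : nat, probability (T n) R)
    (Z : forall n : nat, nat -> {RV (P n) >-> R})
    (Z_iid : forall n : nat, iid_with_cdf (mixture_cdf a sigma n) (Z n))
    (regions : [\/ region1 a sigma, region2 a sigma | region3 a sigma])
    (beta : R) (beta_gt0 : 0 < beta) (beta_lt : beta < beta_plus a sigma) :
  let S (n : nat) : T n -> R := partition_sum n beta (fun j => Z n j) in
  cvg_in_probability_to_cst P
    (fun n (w : T n) => S n w / fine ('E_(P n)[S n])) 1.
Proof.
move=> S eps eps0.
have [C1 C2] :=
  components_controlled sigma_gt0 sigma_neq1 regions beta_gt0 beta_lt.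
pose f1 := beta ^+ 2 / 2.
pose f2 := beta * a + beta ^+ 2 * sigma ^+ 2 / 2.
pose M := Num.max f1 f2.
have [t1 t1_gt0 gap1] : exists2 t0, 0 < t0 & forall t, 0 < t <= t0 ->
    (1 + t) * 0 + (1 + t) ^+ 2 * beta ^+ 2 / 2 < t + (1 + t) * M.
  apply: exponent_gap; rewrite ?add0r ?exprn_gt0// /M ?le_max ?lexx//.
  by case: C1 => ?; [left|right; rewrite lt_max orbC; apply/orP; left].
have [t2 t2_gt0 gap2] : exists2 t0, 0 < t0 & forall t, 0 < t <= t0 ->
    (1 + t) * (beta * a) + (1 + t) ^+ 2 * (beta ^+ 2 * sigma ^+ 2) / 2 <
    t + (1 + t) * M.
  apply: exponent_gap; rewrite ?mulr_gt0 ?exprn_gt0// /M ?le_max ?lexx ?orbT//.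
  by case: C2 => ?; [left|right; rewrite lt_max; apply/orP; left].
(* The bound 1 keeps [p = 1 + t] at most 2; the other two make both gaps positive. *)
pose t := Num.min 1 (Num.min t1 t2).
have t_gt0 : 0 < t by rewrite !lt_min ltr01 t1_gt0.
have [t_le1 t_le_t1 t_le_t2] : [/\ t <= 1, t <= t1 & t <= t2].
  by rewrite /t !ge_min !lexx !orbT.
have {gap1}gap1 := gap1 t; rewrite t_gt0 t_le_t1 in gap1.
have {gap2}gap2 := gap2 t; rewrite t_gt0 t_le_t2 in gap2.
pose p := 1 + t.
pose g1 := p ^+ 2 * beta ^+ 2 / 2.
pose g2 := p * (beta * a) + p ^+ 2 * (beta ^+ 2 * sigma ^+ 2) / 2.
pose c := Num.min (t + p * M - g1) (t + p * M - g2).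
have c_gt0 : 0 < c.
  rewrite lt_min !subr_gt0 gap2// andbT.
  by have := gap1 isT; rewrite mulr0 add0r.
pose m n := 2^-1 * expR (n%:R * f1) + 2^-1 * expR (n%:R * f2).
pose mp n := 2^-1 * expR (n%:R * g1) + 2^-1 * expR (n%:R * g2).
pose N n := Num.truncn (expR n%:R : R).
(* Writing n as the square of its root turns the comparison of exponents into polynomial
   identities. *)
have sqrt2 n : Num.sqrt n%:R ^+ 2 = n%:R :> R by rewrite sqr_sqrtr.
have Em n j : (\int[P n]_w (expR (beta * Num.sqrt n%:R * Z n j w))%:E =
    (m n)%:E)%E.
  rewrite (mixture_mgf _ sigma_gt0 (proj2 (Z_iid n) j)) /m /f1 /f2.
  have := sqrt2 n; set q := Num.sqrt _ => <-.
  by congr (_ * expR _ + _ * expR _)%:E; ring.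
have Emp n j : (\int[P n]_w (expR (p * (beta * Num.sqrt n%:R) * Z n j w))%:E =
    (mp n)%:E)%E.
  rewrite (mixture_mgf _ sigma_gt0 (proj2 (Z_iid n) j)) /mp /g1 /g2.
  have := sqrt2 n; set q := Num.sqrt _ => <-.
  by congr (_ * expR _ + _ * expR _)%:E; ring.
have ES n : fine ('E_(P n)[S n])%E = (N n)%:R * m n.
  rewrite unlock; under eq_integral do rewrite /S/= /partition_sum -sumEFin.
  rewrite ge0_integral_sum//.
    under eq_bigr do rewrite Em.
    by rewrite sumEFin sumr_const card_ord mulr_natl.
  move=> j; apply/measurable_EFinP; apply: measurableT_comp => //.
  by apply: measurable_funM.
pose K := expR ((2 * p - 1) * ln 2).
pose C := 4 / eps ^+ 2 + 2 / eps.
have geo0 (D : R) : D * expR (- c) ^+ n @[n --> \oo] --> (0 : R).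
  rewrite -(mulr0 D); apply: cvgMr; apply: cvg_expr.
  by rewrite gtr0_norm ?expR_gt0// expR_lt1 oppr_lt0.
apply: (@squeeze_cvge _ _ _ _ (cst 0%E) _
  (fun n => (C * K * expR (- c) ^+ n)%:E)).
(* The weak law needs [r <= eps / 2], which the geometric bound on [r] ensures for large n. *)
- have Ksmall : \forall n \near \oo, K * expR (- c) ^+ n < eps / 2.
    by apply: (cvgr_lt _ (geo0 K)); rewrite divr_gt0.
  near=> n; have n_gt0 : (0 < n)%N by near: n; exact: nbhs_infty_gt.
  rewrite measure_ge0/= ES.
  have m_gt0 : 0 < m n by rewrite addr_gt0// mulr_gt0 ?expR_gt0.
  have N_gt0 : (0 < N n)%N.
    rewrite -(ltr_nat R); apply: lt_le_trans (truncn_expR_ge R n_gt0).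
    by rewrite divr_gt0 ?expR_gt0.
  have p_ge1 : 1 <= p by rewrite lerDl ltW.
  have p_le2 : 1 <= p <= 2 by rewrite p_ge1 /p; lra.
  have p1 : p - 1 = t by rewrite /p; ring.
  have cg1 : c + g1 <= p - 1 + p * Num.max f1 f2.
    by rewrite -lerBrDr p1 ge_min lexx.
  have cg2 : c + g2 <= p - 1 + p * Num.max f1 f2.
    by rewrite -lerBrDr p1 ge_min lexx orbT.
  have rle := @moment_ratio_le _ f1 f2 g1 g2 p c (N n)%:R (m n) n n_gt0 p_ge1
    cg1 cg2 erefl erefl.
  apply: le_trans (exp_sum_weak_law (proj1 (Z_iid n)) N_gt0 m_gt0 eps0 p_le2
    (Em n) (Emp n) _) _.
    by apply: le_trans rle _; apply: ltW; near: n.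
  rewrite lee_fin -[X in _ <= X]mulrA; apply: ler_wpM2l rle.
  by rewrite addr_ge0// ?divr_ge0// ?sqr_ge0// ltW.
- exact: cvg_cst.
- by apply/cvg_EFin; [exact: nearW|exact: geo0].
Unshelve. all: by end_near.
Qed.
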